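(* The reduced networked passive system $$\boldsymbol{\hat\Sigma}:\quad \dot{\hat x}=(I_k\otimes\hat A-\hat L\otimes\hat B\hat C)\hat x+(\hat F\otimes\hat B)u,\qquad \hat y=(\hat H\otimes\hat C)\hat x,$$ preserves synchronization: when $u=0$, $$\lim_{t\to\infty}\left[\hat x_i(t)-\hat x_j(t)\right]=0\qquad\text{for all } i,j\in\{1,\dots,k\},$$ for any initial condition $\hat x(0)$, where $\hat x=[\hat x_1^\top,\dots,\hat x_k^\top]^\top$ with each $\hat x_i$ of the dimension of $\hat A$.
   Context: Original data. Agents: $\dot x_i=Ax_i+B\nu_i$, $\eta_i=Cx_i$ with $A\in\mathbb{R}^{n\times n}$, $B\in\mathbb{R}^{n\times m}$, $C\in\mathbb{R}^{m\times n}$, minimal and passive. Passive means that there is a symmetric positive definite $K$ with $A^\top K+KA\le0$, $C=B^\top K$. Let $K_m$, $K_M$ be the minimum and maximum (Loewner order) symmetric positive definite solutions $K$ of the relations $A^\top K+KA\le0$, $C=B^\top K$. $L\in\mathbb{R}^{N\times N}$ is the Laplacian of a connected undirected weighted graph ($L_{ij}=-w_{ij}$ for $i\neq j$, $L_{ii}=\sum_{j\ne i}w_{ij}$, $w_{ij}=w_{ji}\ge0$), $F\in\mathbb{R}^{N\times p}$, $H\in\mathbb{R}^{q\times N}$. Fix $L=T\,\mathrm{blkdiag}(\bar\Lambda,0)T^\top$ with $T=[T_1\ T_2]$ orthogonal, $T_2=\mathbf 1_N/\sqrt N$, $\bar\Lambda=\mathrm{blkdiag}(\bar\lambda_1I_{m_1},\dots,\bar\lambda_sI_{m_s})$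 with $\bar\lambda_1>\cdots>\bar\lambda_s>0$ the distinct nonzero eigenvalues of $L$. Set $\bar F=T_1^\top F$, $\bar H=HT_1$. Balancing. $X=X^\top>0$ satisfies $-\bar\Lambda X-X\bar\Lambda+\bar F\bar F^\top=0$, and $Y=\mathrm{blkdiag}(Y_1,\dots,Y_s)$, $Y_i=Y_i^\top>0$ in $\mathbb{R}^{m_i\times m_i}$, satisfies $-\bar\Lambda Y-Y\bar\Lambda+\bar H^\top\bar H\le0$. Nonsingular $T_{\mathcal G},T_{\mathcal D}$ satisfy $T_{\mathcal G}XT_{\mathcal G}^\top=T_{\mathcal G}^{-\top}YT_{\mathcal G}^{-1}=\mathrm{diag}(\sigma_1,\dots,\sigma_{N-1})$ and $T_{\mathcal D}K_M^{-1}T_{\mathcal D}^\top=T_{\mathcal D}^{-\top}K_mT_{\mathcal D}^{-1}=\mathrm{diag}(\tau_1,\dots,\tau_n)$, with nonincreasing diagonal entries. Truncation to $k\le N$ nodes and agent order $r\le n$. $(\hat\Lambda_1,\hat F_1,\hat H_1)$ consists of the leading $(k-1)\times(k-1)$ block of $T_{\mathcal G}\bar\Lambda T_{\mathcal G}^{-1}$, the first $k-1$ rows of $T_{\mathcal G}\bar F$, and the first $k-1$ columns of $\bar HT_{\mathcal G}^{-1}$. $(\hat A,\hat B,\hat C)$ consists of the leading $r\times r$ block of $T_{\mathcal D}AT_{\mathcal D}^{-1}$, the first $r$ rows of $T_{\mathcal D}B$, and the first $r$ columns of $CT_{\mathcal D}^{-1}$; if this realization is not minimal it is replaced by a minimal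 realization of the same transfer function. Standing convention: the reduced agent $(\hat A,\hat B,\hat C)$ is thus passive (that is, there is a symmetric positive definite $\hat K$ with $\hat A^\top\hat K+\hat K\hat A\le0$, $\hat C=\hat B^\top\hat K$) and minimal. Network realization. Put $$\mathcal N=\begin{bmatrix}\hat\Lambda_1&0\\0&0\end{bmatrix},\quad \mathcal F=\begin{bmatrix}\hat F_1\\ \tfrac1{\sqrt N}\mathbf 1_N^\top F\end{bmatrix},\quad \mathcal H=\begin{bmatrix}\hat H_1&\tfrac1{\sqrt N}H\mathbf 1_N\end{bmatrix}.$$ $\mathcal T_n$ is a nonsingular matrix such that $\hat L=\mathcal T_n^{-1}\mathcal N\mathcal T_n$ is the Laplacian matrix of a connected undirected weighted graph on $k$ nodes, and $\hat F=\mathcal T_n^{-1}\mathcal F$, $\hat H=\mathcal H\mathcal T_n$. *)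

(* Defs.v *)
From HB Require Import structures.
From mathcomp Require Import all_boot all_order all_algebra.
From mathcomp Require Import classical_sets reals topology normedtype derive.
From mathcomp.real_closed Require Export mxtens.

Set Implicit Arguments.
Unset Strict Implicit.
Unset Printing Implicit Defensive.

Import Order.TTheory GRing.Theory Num.Theory.
Import numFieldNormedType.Exports.

Local Open Scope classical_set_scope.
Local Open Scope ring_scope.

Section QuadraticForms.
Variables (R : realType) (n : nat).
Implicit Types (K P Q : 'M[R]_n).

Definition loewner_le P Q : Prop :=
  forall x : 'cV[R]_n, (x^T *m P *m x) 0 0 <= (x^T *m Q *m x) 0 0.

Definition sym_posdef K : Prop :=
  K^T = K /\ forall x : 'cV[R]_n, x != 0 -> 0 < (x^T *m K *m x) 0 0.

End QuadraticForms.

Section LinearSystems.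
Variables (R : realType).

(* The rational matrix C (sI - A)^-1 B, where s is 'X in R(X). *)
Definition transfer n m p (A : 'M[R]_n) (B : 'M[R]_(n, m)) (C : 'M[R]_(p, n))
    : 'M[{fraction {poly R}}]_(p, m) :=
  map_mx (fun c => tofrac c%:P) C
    *m invmx (map_mx (@tofrac _) (char_poly_mx A))
    *m map_mx (fun c => tofrac c%:P) B.

Definition minimal_realization n m p
    (A : 'M[R]_n) (B : 'M[R]_(n, m)) (C : 'M[R]_(p, n)) : Prop :=
  forall n' (A' : 'M[R]_n') (B' : 'M[R]_(n', m)) (C' : 'M[R]_(p, n')),
    transfer A' B' C' = transfer A B C -> (n <= n')%N.

Definition passivity_certificate n m
    (A : 'M[R]_n) (B : 'M[R]_(n, m)) (C : 'M[R]_(m, n)) (K : 'M[R]_n) : Prop :=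
  [/\ sym_posdef K, loewner_le (A^T *m K + K *m A) 0 & C = B^T *m K].

Definition passive n m
    (A : 'M[R]_n) (B : 'M[R]_(n, m)) (C : 'M[R]_(m, n)) : Prop :=
  exists K, passivity_certificate A B C K.

Definition min_certificate n m
    (A : 'M[R]_n) (B : 'M[R]_(n, m)) (C : 'M[R]_(m, n)) (Km : 'M[R]_n) : Prop :=
  passivity_certificate A B C Km /\
  forall K, passivity_certificate A B C K -> loewner_le Km K.

Definition max_certificate n m
    (A : 'M[R]_n) (B : 'M[R]_(n, m)) (C : 'M[R]_(m, n)) (KM : 'M[R]_n) : Prop :=
  passivity_certificate A B C KM /\
  forall K, passivity_certificate A B C K -> loewner_le K KM.

(* [reduce_to_minimal A B C A' B' C']: the realization (A', B', C') is (A, B, C)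
   itself when the latter is minimal, and otherwise any minimal realization of
   the same transfer function, whose order r' may differ from r. *)
Inductive reduce_to_minimal r m p
    (A : 'M[R]_r) (B : 'M[R]_(r, m)) (C : 'M[R]_(p, r)) :
    forall r', 'M[R]_r' -> 'M[R]_(r', m) -> 'M[R]_(p, r') -> Prop :=
| ReduceKeep : minimal_realization A B C -> reduce_to_minimal A B C A B C
| ReduceReplace r' (A' : 'M[R]_r') (B' : 'M[R]_(r', m)) (C' : 'M[R]_(p, r')) :
    ~ minimal_realization A B C ->
    minimal_realization A' B' C' ->
    transfer A' B' C' = transfer A B C ->
    reduce_to_minimal A B C A' B' C'.

(* x is a solution on [0, +oo[: differentiable on ]0, +oo[ and continuous from
   the right at the initial time. *)
Definition solution n m p
    (A : 'M[R]_n) (B : 'M[R]_(n, m)) (C : 'M[R]_(p, n)) (x0 : 'cV[R]_n)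
    (u : R -> 'cV[R]_m) (x : R -> 'cV[R]_n) (y : R -> 'cV[R]_p) : Prop :=
  [/\ x 0 = x0,
      x t @[t --> (0 : R)^'+] --> x0,
      forall t : R, 0 < t -> is_derive t 1 x (A *m x t + B *m u t)
    & forall t : R, 0 <= t -> y t = C *m x t].

End LinearSystems.

Section Networks.
Variables (R : realType).

Definition connected_laplacian N (L : 'M[R]_N) : Prop :=
  exists w : 'M[R]_N,
    [/\ forall i j, w i j = w j i,
        forall i j, 0 <= w i j,
        forall i j, i != j -> L i j = - w i j,
        forall i, L i i = \sum_(j | j != i) w i j
      & forall i j, connect (fun a b => 0 < w a b) i j].

Definition ones N : 'cV[R]_N := const_mx 1.

Definition nonincreasing_diag n (d : 'rV[R]_n) : Prop :=
  forall i j : 'I_n, (i <= j)%N -> d 0 j <= d 0 i.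

Definition leading_block n r (hr : (r <= n)%N) (M : 'M[R]_n) : 'M[R]_r :=
  mxsub (widen_ord hr) (widen_ord hr) M.

Definition first_rows n r (hr : (r <= n)%N) m (M : 'M[R]_(n, m)) : 'M[R]_(r, m) :=
  rowsub (widen_ord hr) M.

Definition first_cols n r (hr : (r <= n)%N) m (M : 'M[R]_(m, n)) : 'M[R]_(m, r) :=
  colsub (widen_ord hr) M.

(* With x = [x_1; ...; x_k] stacked compatibly with the Kronecker product
   [tensmx], the entry a of x_i is the entry i * r + a of x. *)
Definition agent_state k r (i : 'I_k) (x : 'cV[R]_(k * r)) : 'cV[R]_r :=
  \col_a x (mxtens_index (i, a)) 0.

End Networks.

Arguments ones {R} N.

(* Main.v *)
Require Import Defs.
From HB Require Import structures.
From mathcomp Require Import all_boot all_order all_algebra.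
From mathcomp Require Import classical_sets reals topology normedtype derive.
From mathcomp Require Import boolp functions realfun.
From mathcomp Require Import ring lra.
Import Order.TTheory GRing.Theory Num.Theory.
Import numFieldNormedType.Exports.
Local Open Scope classical_set_scope.
Local Open Scope ring_scope.

Set Implicit Arguments.
Unset Strict Implicit.
Unset Printing Implicit Defensive.

(** The reduced system is again a network of passive minimal agents [(A, B, C)]
    coupled through the Laplacian [L] of a connected graph, and every such
    network synchronizes ([passive_network_synchronizes]), for the following
    reason.

    Let [K] certify passivity, let [x_i] be the state of agent [i] and
    [y_i = C x_i].  The total storage [V = sum_i x_i^T K x_i] satisfies
      [V' = sum_i x_i^T (A^T K + K A) x_i - sum_(i,j) w_ij |y_i - y_j|^2],
    where the coupling term comes from [K B = C^T] and from the Dirichlet form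
    of [L] ([network_dissipation]).  Both parts are nonpositive, so [V] converges
    and, [K] being positive definite, the state stays bounded.  Barbalat's lemma
    ([barbalat]) then gives [V' --> 0]: the outputs of neighbours, hence by
    connectedness those of all agents, agree asymptotically.

    It remains to pass from outputs to states.  For a linear form [l] with
    [l x(t) --> 0], the function [l x(t)] has a bounded second derivative, so
    its derivative [l M x(t)] tends to [0] as well ([decays_generator]), [M] being
    the generator of the network.  Consider the row vectors [w] such that
    [sum_i e_i (w x_i) --> 0] whenever [sum_i e_i = 0].  They form a linear
    space that contains the rows of [C]; it is stable under [w |-> w A] because
    the coupling term [w B C sum_i (e L)_i x_i] that [M] adds is itself such a
    combination of output differences.  Observability, which is what minimality
    provides here ([observability_ind]), says that this space is everything, and
    the difference of two unit vectors, taken as [e], gives synchronization. *)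

(** * Scalar functions on a half-line *)

Lemma mvt_increment (R : realType) (f df : R -> R) (a b : R) :
  0 < a -> a < b -> (forall t : R, 0 < t -> is_derive t 1 f (df t)) ->
  exists2 c, a < c < b & f b - f a = df c * (b - a).
Proof.
move=> a0 ab fdf.
have [||c cab ->] := @MVT R f df a b ab.
- move=> t; rewrite in_itv/= => /andP[lt_at _]; exact: fdf (lt_trans a0 lt_at).
- apply: derivable_within_continuous => t; rewrite in_itv/= => /andP[le_at _].
  by have [] := fdf t (lt_le_trans a0 le_at).
by exists c => //; move: cab; rewrite in_itv.
Qed.

(** Over a step of fixed small length [d], the increment of [f] is [d] times a
    value of [f'], which is within [c * d] of [f' t] as [f'] is [c]-Lipschitz;
    and the increment tends to [0]. *)
Lemma barbalat (R : realType) (f f' f'' : R -> R) (c l : R) :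
  (forall t : R, 0 < t -> is_derive t 1 f (f' t)) ->
  (forall t : R, 0 < t -> is_derive t 1 f' (f'' t)) ->
  (forall t : R, 1 <= t -> `|f'' t| <= c) ->
  f t @[t --> +oo] --> l -> f' t @[t --> +oo] --> 0.
Proof.
move=> ff' f'f'' f''c fl.
have c0 : 0 <= c := le_trans (normr_ge0 _) (f''c 1 (lexx 1)).
apply/cvgr0Pnorm_le => e e0.
(* This choice makes the Lipschitz error [c * d] at most [e / 2]. *)
pose d : R := e / (2 * (c + 1)).
have c1 : 0 < c + 1 by rewrite ltr_wpDl.
have d0 : 0 < d by rewrite divr_gt0// mulr_gt0.
have e1 : 0 < d * e / 4.
  by rewrite divr_gt0 ?(mulr_gt0 d0 e0) ?ltr0n.
have /cvgrPdist_le /(_ _ e1) [T [_ fT]] := fl.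
near=> t.
have t1 : 1 <= t by near: t; apply: nbhs_pinfty_ge; rewrite num_real.
have tT : T < t by near: t; apply: nbhs_pinfty_gt; rewrite num_real.
have t0 : 0 < t := lt_le_trans ltr01 t1.
have ttd : t < t + d by rewrite ltrDl.
have [u /andP[tu utd] fu] := mvt_increment t0 ttd ff'.
have [v /andP[tv vu] fv] := mvt_increment t0 tu f'f''.
have f'tu : `|f' u - f' t| <= c * d.
  rewrite fv normrM ler_pM// ?f''c//; first exact: le_trans (ltW tv).
  by rewrite ger0_norm ?subr_ge0 ?(ltW tu)// lerBlDl ltW.
have f'u : `|f' u| <= e / 2.
  have : `|f (t + d) - f t| <= d * e / 2.
    have h1 := fT t tT; have h2 := fT (t + d) (lt_trans tT ttd).
    have -> : f (t + d) - f t = (l - f t) - (l - f (t + d)) by lra.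
    apply: (le_trans (ler_normB _ _)); lra.
  rewrite fu (_ : t + d - t = d); last by lra.
  by rewrite normrM (gtr0_norm d0) mulrC -mulrA ler_pM2l.
have cd : c * d <= e / 2.
  rewrite /d invfM mulrA [leLHS]mulrA -mulrA mulrCA.
  have : c / (c + 1) <= 1 by rewrite ler_pdivrMr// mul1r; lra.
  have : 0 < e / 2 by lra.
  rewrite mulrAC; nra.
rewrite -(subrK (f' u) (f' t)) (le_trans (ler_normD _ _))// distrC; lra.
Unshelve. all: by end_near.
Qed.

Lemma nonincreasing_bounded_cvg (R : realType) (f f' : R -> R) :
  (forall t : R, 0 < t -> is_derive t 1 f (f' t)) ->
  (forall t : R, 0 < t -> f' t <= 0) -> (forall t, 0 <= f t) ->
  (forall t : R, 1 <= t -> f t <= f 1) /\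
  exists l : R, f t @[t --> +oo] --> l.
Proof.
move=> ff' f'0 f0.
have dec (s t : R) : 1 <= s -> s <= t -> f t <= f s.
  move=> s1 st.
  apply: (@ler0_derive1_nincry R f 1) => // [u|u|].
  - rewrite in_itv/= andbT => u1; have [] := ff' u (lt_trans ltr01 u1) => //.
  - rewrite in_itv/= andbT => u1.
    rewrite derive1E; have [_ ->] := ff' u (lt_trans ltr01 u1).
    exact: f'0 (lt_trans ltr01 u1).
  - apply: derivable_within_continuous => u; rewrite in_itv/= andbT => u1.
    by have [] := ff' u (lt_le_trans ltr01 u1).
split=> [t t1|]; first exact: dec.
(* [f] is monotone to the right of [1] only; freezing it to the left of [1]
   gives a globally monotone function. *)
pose g t := - f (Num.max t 1).
have /nondecreasing_cvgr : {homo g : s t / s <= t}.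
  move=> s t st; rewrite lerN2; apply: dec; first by rewrite le_max lexx orbT.
  by rewrite ge_max !le_max st lexx/= orbT.
have ubg : has_ubound (range g).
  by exists 0 => _ [t _ <-]; rewrite oppr_le0.
move=> /(_ ubg) /cvgN gl; exists (- sup (range g)).
apply: cvg_trans gl; apply: near_eq_cvg; near=> t.
have t1 : 1 <= t by near: t; apply: nbhs_pinfty_ge; rewrite num_real.
by rewrite /g /= opprK max_l.
Unshelve. all: by end_near.
Qed.

Lemma cvg0_of_sqr_le (R : realType) (c : R) (f g : R -> R) :
  0 < c ->
  (\forall t \near +oo, c * f t ^+ 2 <= g t) ->
  g t @[t --> +oo] --> (0 : R) -> f t @[t --> +oo] --> (0 : R).
Proof.
move=> c0 fg /cvgr0Pnorm_le g0; apply/cvgr0Pnorm_le => e e0.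
have ce0 : 0 < c * e ^+ 2 by rewrite mulr_gt0// exprn_gt0.
have := g0 _ ce0; apply: filterS2 fg => t fgt gt.
rewrite -(@ler_pXn2r _ 2) ?nnegrE ?(ltW e0)//.
rewrite -normrX ger0_norm ?sqr_ge0// -(ler_pM2l c0).
exact: le_trans fgt (le_trans (ler_norm _) gt).
Qed.

(** * Minimality and observability *)

(** A linear subspace given as a mere proposition is the row space of a matrix:
    take one of maximal rank among those whose row space lies in it. *)
Lemma row_space_of_linear_pred (R : fieldType) (n : nat) (P : 'rV[R]_n -> Prop) :
  P 0 -> (forall a u v, P u -> P v -> P (a *: u + v)) ->
  exists W : 'M[R]_n, forall w, P w <-> (w <= W)%MS.
Proof.
move=> P0 Plin.
pose Q k := `[< exists W : 'M[R]_n, \rank W = k /\ forall w, (w <= W)%MS -> P w >].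
have exQ : exists k, Q k.
  exists 0%N; apply/asboolP; exists 0; split; first exact: mxrank0.
  by move=> w; rewrite submx0 => /eqP->.
have ubQ k : Q k -> (k <= n)%N by case/asboolP => W [<- _]; exact: rank_leq_row.
case: (ex_maxnP exQ ubQ) => k /asboolP[W [rW PW]] maxW.
exists W => w; split=> [Pw|]; last exact: PW.
suff /mxrank_leqif_eq[_ ] : (W <= W + w)%MS.
  have -> : \rank W == \rank (W + w)%MS.
    rewrite eqn_leq (mxrankS (addsmxSl _ _))/= rW maxW//.
    apply/asboolP; exists (W + w)%MS; split=> // u /sub_addsmxP[[u1 u2] /= ->].
    rewrite addrC [u2]mx11_scalar mul_scalar_mx.
    by apply: Plin => //; apply: PW; exact: submxMl.
  by move=> /esym /eqmxP ->; exact: addsmxSr.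
exact: addsmxSl.
Qed.

Section Intertwining.
Variable R : realType.
Local Notation toX := (fun c : R => tofrac (c%:P) : {fraction {poly R}}).

Lemma char_poly_mx_frac_unit (n : nat) (A : 'M[R]_n) :
  map_mx (@tofrac _) (char_poly_mx A) \in unitmx.
Proof.
rewrite unitmxE det_map_mx unitfE tofrac_eq0.
exact/monic_neq0/char_poly_monic.
Qed.

(** [Q] also intertwines the resolvents, so that
    [C' (s - A')^-1 Q B = C' Q (s - A)^-1 B].  No invertibility of [Q] is
    involved, hence [A'] may act on a smaller space. *)
Lemma transfer_intertwine (n r m p : nat) (A : 'M[R]_n) (B : 'M[R]_(n, m))
    (C : 'M[R]_(p, n)) (Q : 'M[R]_(r, n)) (A' : 'M[R]_r) (C' : 'M[R]_(p, r)) :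
  C = C' *m Q -> Q *m A = A' *m Q -> transfer A' (Q *m B) C' = transfer A B C.
Proof.
move=> -> QA; rewrite /transfer.
have mapM a b c (M : 'M[R]_(a, b)) (N : 'M[R]_(b, c)) :
    map_mx toX (M *m N) = map_mx toX M *m map_mx toX N.
  by rewrite (map_mxM (@tofrac _ \o polyC)).
have mapE a b (M : 'M[R]_(a, b)) : map_mx toX M = map_mx (@tofrac _) (map_mx polyC M).
  by rewrite -map_mx_comp.
have swap : map_mx toX Q *m map_mx (@tofrac _) (char_poly_mx A) =
            map_mx (@tofrac _) (char_poly_mx A') *m map_mx toX Q.
  rewrite mapE -!map_mxM; congr map_mx.
  by rewrite /char_poly_mx mulmxBr mulmxBl -!map_mxM QA scalar_mxC.
have resolvent : invmx (map_mx (@tofrac _) (char_poly_mx A')) *m map_mx toX Q =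
    map_mx toX Q *m invmx (map_mx (@tofrac _) (char_poly_mx A)).
  apply: (canRL (mulmxK (char_poly_mx_frac_unit _))).
  by rewrite -mulmxA swap mulKmx// char_poly_mx_frac_unit.
by rewrite !mapM !mulmxA -(mulmxA _ _ (map_mx toX Q)) resolvent !mulmxA.
Qed.

End Intertwining.

(** If [W] had a smaller rank, a row basis [Q] of [W] would satisfy
    [C = C' Q] and [Q A = A' Q], and [transfer_intertwine] would yield a
    realization of smaller order. *)
Lemma minimal_observable (R : realType) (n m p : nat) (A : 'M[R]_n)
    (B : 'M[R]_(n, m)) (C : 'M[R]_(p, n)) (W : 'M[R]_n) :
  minimal_realization A B C -> (C <= W)%MS -> stablemx W A -> row_full W.
Proof.
move=> minABC CW WA.
rewrite -col_leq_rank.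
rewrite -(eq_row_base W) in CW.
have /submxP[A' QA] : (row_base W *m A <= row_base W)%MS.
  by rewrite (eqmxMr A (eq_row_base W)) (eq_row_base W).
have /submxP[C' CQ] := CW.
exact: minABC (transfer_intertwine B CQ QA).
Qed.

(** Observability as an induction principle: the rows of the matrices [C A^k]
    span all row vectors. *)
Lemma observability_ind (R : realType) (n m p : nat) (A : 'M[R]_n)
    (B : 'M[R]_(n, m)) (C : 'M[R]_(p, n)) (P : 'rV[R]_n -> Prop) :
  minimal_realization A B C ->
  P 0 -> (forall a u v, P u -> P v -> P (a *: u + v)) ->
  (forall c, P (row c C)) -> (forall w, P w -> P (w *m A)) ->
  forall w, P w.
Proof.
move=> minABC P0 Plin PC PA w.
have [W PW] := row_space_of_linear_pred P0 Plin.
apply/PW/submx_full/(minimal_observable minABC).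
  by apply/row_subP => c; exact/PW.
by apply/row_subP => i; rewrite row_mul; apply/PW/PA/PW; exact: row_sub.
Qed.

(** * Trajectories of linear systems and quadratic Lyapunov functions *)

Lemma posdef_ge0 (R : realType) (n : nat) (K : 'M[R]_n) (x : 'cV[R]_n) :
  sym_posdef K -> 0 <= (x^T *m K *m x) 0 0.
Proof.
by move=> [_ posK]; have [->|/posK/ltW//] := eqVneq x 0; rewrite mulmx0 mxE.
Qed.

Lemma posdef_unitmx (R : realType) (n : nat) (K : 'M[R]_n) :
  sym_posdef K -> K \in unitmx.
Proof.
move=> [_ Kpos]; rewrite -row_free_unit -kermx_eq0.
apply/eqP/row_matrixP => i; rewrite row0.
apply/eqP; apply: contraT => v0.
have := Kpos (row i (kermx K))^T; rewrite trmx_eq0 => /(_ v0).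
by rewrite trmxK -row_mul mulmx_ker row0 mul0mx mxE ltxx.
Qed.

(** Expand the nonnegative form [K] at [x + v] and [x - v], where [v] represents
    [l / 2] in the inner product of [K].  This affine bound is
    all that boundedness of trajectories requires from definiteness. *)
Lemma linear_form_le_posdef (R : realType) (n : nat) (K : 'M[R]_n) (l : 'rV[R]_n) :
  sym_posdef K ->
  exists c, forall x : 'cV[R]_n, `|(l *m x) 0 0| <= (x^T *m K *m x) 0 0 + c.
Proof.
move=> posK; have Ku := posdef_unitmx posK; have [symK _] := posK.
have [v Kv] : exists v : 'cV[R]_n, v^T *m K = 2^-1 *: l.
  exists (2^-1 *: (invmx K *m l^T)).
  by rewrite linearZ/= trmx_mul trmxK trmx_inv symK -scalemxAl mulmxKV.
exists ((v^T *m K *m v) 0 0) => x.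
have sq (a : R) : a ^+ 2 = 1 -> ((x + a *: v)^T *m K *m (x + a *: v)) 0 0 =
   (x^T *m K *m x) 0 0 + (v^T *m K *m v) 0 0 + a * (l *m x) 0 0.
  move=> a2.
  have xKv : x^T *m K *m v = 2^-1 *: (l *m x).
    have -> : x^T *m K *m v = (v^T *m K *m x)^T.
      by rewrite !trmx_mul trmxK symK mulmxA.
    by rewrite Kv -scalemxAl [l *m x]mx11_scalar scale_scalar_mx tr_scalar_mx.
  have -> : (x + a *: v)^T = x^T + a *: v^T by rewrite linearD linearZ.
  rewrite !(mulmxDl, mulmxDr) -!scalemxAl -!scalemxAr.
  rewrite Kv xKv -!scalemxAl.
  move: (l *m x) (l *m v) (x^T *m K *m x) => lx lv V; rewrite !mxE.
  rewrite (mulrA a a) -[a * a]expr2 a2 mul1r; lra.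
have := posdef_ge0 (x + 1 *: v) posK; have := posdef_ge0 (x + (-1) *: v) posK.
rewrite !sq ?expr1n ?sqrrN ?expr1n// => h1 h2.
rewrite ler_norml; lra.
Qed.

Section Trajectory.
Variables (R : realType) (N : nat) (M : 'M[R]_N) (x : R -> 'cV[R]_N).

(** At time [0] a solution is only continuous from the right, so the equation is
    imposed for positive times. *)
Definition trajectory := forall t : R, 0 < t -> is_derive t 1 x (M *m x t).

Definition linear_forms_bounded :=
  forall l : 'rV[R]_N, exists c, forall t : R, 1 <= t -> `|(l *m x t) 0 0| <= c.

Definition decays (l : 'rV[R]_N) := (l *m x t) 0 0 @[t --> +oo] --> (0 : R).

Hypothesis xM : trajectory.

Lemma is_derive_linear_form (l : 'rV[R]_N) (t : R) : 0 < t ->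
  is_derive t 1 (fun t => (l *m x t) 0 0) ((l *m M *m x t) 0 0).
Proof.
move=> /xM[dx Dx].
have dxi i : is_derive t 1 (fun t => x t i 0) ((M *m x t) i 0).
  have dxi := (derivable_mxP _ _ _).1 dx i 0.
  by apply: DeriveDef => //; rewrite -Dx derive_mx// mxE.
have -> : (fun t => (l *m x t) 0 0) = \sum_i (fun t => l 0 i *: (x t i 0 : R)).
  by apply/funext => u; rewrite fct_sumE mxE.
by rewrite -mulmxA mxE; apply: is_derive_sum.
Qed.

Lemma is_derive_quadratic_form (Q : 'M[R]_N) (t : R) : 0 < t ->
  is_derive t 1 (fun t => ((x t)^T *m Q *m x t) 0 0)
    (((x t)^T *m (M^T *m Q + Q *m M) *m x t) 0 0).
Proof.
move=> t0.
have -> : (fun t => ((x t)^T *m Q *m x t) 0 0) =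
   \sum_i (fun t => ((delta_mx 0 i : 'rV_N) *m x t) 0 0 * (row i Q *m x t) 0 0).
  apply/funext => u; rewrite fct_sumE -mulmxA mxE; apply: eq_bigr => i _.
  by rewrite mxE -rowE -row_mul !mxE.
pose d i := ((delta_mx 0 i : 'rV_N) *m x t) 0 0 * (row i Q *m M *m x t) 0 0
          + (row i Q *m x t) 0 0 * ((delta_mx 0 i : 'rV_N) *m M *m x t) 0 0.
have -> : ((x t)^T *m (M^T *m Q + Q *m M) *m x t) 0 0 = \sum_i d i.
  rewrite mulmxDr mulmxDl mxE big_split/= addrC; congr (_ + _).
    rewrite -!mulmxA mxE; apply: eq_bigr => i _.
    by rewrite mxE -rowE -!mulmxA -row_mul !mxE.
  rewrite !mulmxA -trmx_mul -mulmxA mxE; apply: eq_bigr => i _.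
  by rewrite mxE -mulmxA -rowE -row_mul !mxE mulrC.
apply: is_derive_sum => i; apply: is_deriveM; exact: is_derive_linear_form.
Qed.

Lemma quadratic_form_bounded (Q : 'M[R]_N) : linear_forms_bounded ->
  exists c, forall t : R, 1 <= t -> `|((x t)^T *m Q *m x t) 0 0| <= c.
Proof.
move=> bx.
have [c xc] := choice (fun i => bx (delta_mx 0 i : 'rV_N)).
have [d xd] := choice (fun i => bx (row i Q)).
exists (\sum_i c i * d i) => t t1; rewrite -mulmxA mxE.
apply: (le_trans (ler_norm_sum _ _ _)); apply: ler_sum => i _.
rewrite normrM ler_pM//.
  by have := xc i t t1; rewrite -rowE !mxE.
by have := xd i t t1; rewrite -row_mul mxE.
Qed.

(** [barbalat] for [l x(t)], whose successive derivatives are [l M x(t)] and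
    [l M M x(t)]. *)
Lemma decays_generator (l : 'rV[R]_N) :
  linear_forms_bounded -> decays l -> decays (l *m M).
Proof.
move=> bx dl; have [c xc] := bx (l *m M *m M).
apply: (barbalat _ _ xc dl) => t t0; exact: is_derive_linear_form.
Qed.

(** [V = x^T K x] is nonincreasing and bounds every linear form; its second
    derivative is again a quadratic form in the bounded [x], so [barbalat]
    applies to [V]. *)
Lemma lyapunov_dissipation (K : 'M[R]_N) :
  sym_posdef K -> loewner_le (M^T *m K + K *m M) 0 ->
  linear_forms_bounded /\
  ((x t)^T *m (M^T *m K + K *m M) *m x t) 0 0 @[t --> +oo] --> (0 : R).
Proof.
move=> Kpos Kdiss.
have Vder := is_derive_quadratic_form K.
have [t0 u0|t|V1 [l Vl]] := nonincreasing_bounded_cvg Vder.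
- by have := Kdiss (x t0); rewrite mulmx0 mul0mx [leRHS]mxE.
- exact: posdef_ge0.
have bx : linear_forms_bounded.
  move=> f; have [c fc] := linear_form_le_posdef f Kpos.
  exists (((x 1)^T *m K *m x 1) 0 0 + c) => t t1; apply: le_trans (fc _) _.
  by rewrite lerD2r; exact: V1.
split=> //.
have [c xc] := quadratic_form_bounded
  (M^T *m (M^T *m K + K *m M) + (M^T *m K + K *m M) *m M) bx.
by apply: (barbalat _ _ xc Vl) => t t0; exact: is_derive_quadratic_form.
Qed.

End Trajectory.

Lemma decays_lin (R : realType) (N : nat) (x : R -> 'cV[R]_N) (a : R) (u v : 'rV[R]_N) :
  decays x u -> decays x v -> decays x (a *: u + v).
Proof.
move=> du dv; rewrite /decays.
have -> : (fun t => ((a *: u + v) *m x t) 0 0) =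
          (fun t => a * (u *m x t) 0 0 + (v *m x t) 0 0).
  by apply/funext => t; rewrite mulmxDl -scalemxAl !mxE.
by have := cvgD (cvgM (cvg_cst a) du) dv; rewrite mulr0 addr0; exact.
Qed.

(** * Laplacian quadratic forms *)

Section LaplacianForms.
Variables (R : realType) (k : nat) (L w : 'M[R]_k).
Hypothesis wsym : forall i j, w i j = w j i.
Hypothesis Loff : forall i j, i != j -> L i j = - w i j.
Hypothesis Ldiag : forall i, L i i = \sum_(j | j != i) w i j.

Lemma laplacian_row_apply (a : 'I_k -> R) i :
  \sum_j L i j * a j = \sum_j w i j * (a i - a j).
Proof.
rewrite (bigD1 i)//= [RHS](bigD1 i)//= subrr mulr0 add0r Ldiag mulr_suml.
rewrite -big_split/=; apply: eq_bigr => j ji.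
by rewrite Loff 1?eq_sym// mulNr -mulrBr.
Qed.

Lemma laplacian_mul_ones : L *m ones k = 0.
Proof.
apply/colP => i; rewrite !mxE.
under eq_bigr do rewrite mxE.
rewrite (laplacian_row_apply (fun=> 1)) big1// => j _.
by rewrite subrr mulr0.
Qed.

Lemma laplacian_sym : L^T = L.
Proof.
apply/matrixP => i j; rewrite mxE.
by have [->//|ij] := eqVneq i j; rewrite !Loff// 1?eq_sym// wsym.
Qed.

(** Symmetrization: as the rows of [L] sum to zero, [sum L_ij a_i a_j] equals
    [sum w_ij a_i (a_i - a_j)], and adding to the latter its image under the
    exchange of [i] and [j] gives the sum of squares. *)
Lemma laplacian_dirichlet (a : 'I_k -> R) :
  2 * (\sum_i \sum_j L i j * (a i * a j)) =
  \sum_i \sum_j w i j * (a i - a j) ^+ 2.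
Proof.
have form : \sum_i \sum_j L i j * (a i * a j) =
            \sum_i \sum_j w i j * (a i * (a i - a j)).
  apply: eq_bigr => i _.
  transitivity (a i * \sum_j L i j * a j).
    by rewrite mulr_sumr; apply: eq_bigr => j _; rewrite mulrCA.
  rewrite laplacian_row_apply mulr_sumr.
  by apply: eq_bigr => j _; rewrite mulrCA.
rewrite mulr2n mulrDl !mul1r form {2}exchange_big -big_split/=.
apply: eq_bigr => i _; rewrite -big_split/=; apply: eq_bigr => j _.
rewrite [w j i]wsym; ring.
Qed.

End LaplacianForms.

(** * Kronecker products acting on stacked agent states *)

Section Kronecker.
Variables (R : realType) (k r : nat).
Implicit Types (x : 'cV[R]_(k * r)).

Lemma sum_mxtens (f : 'I_(k * r) -> R) :
  \sum_i f i = \sum_i \sum_a f (mxtens_index (i, a)).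
Proof.
rewrite pair_big/= (reindex (@mxtens_index k r)).
  by apply: eq_bigr => -[].
by exists (@mxtens_unindex k r) => i _; rewrite ?mxtens_indexK ?mxtens_unindexK.
Qed.

Lemma agent_state_tens_mul (S : 'M[R]_k) (Q : 'M[R]_r) x i :
  agent_state i ((S *t Q) *m x) = \sum_j S i j *: (Q *m agent_state j x).
Proof.
apply/colP => a; rewrite !mxE sum_mxtens summxE; apply: eq_bigr => j _.
rewrite !mxE mulr_sumr; apply: eq_bigr => b _.
by rewrite tensmxE mxE mulrA.
Qed.

(** The linear form [x |-> sum_i e_i (w x_i)].  The type is stated with one row,
    since [*t] alone would give [1 * 1] rows. *)
Definition tens_row (e : 'rV[R]_k) (w : 'rV[R]_r) : 'rV[R]_(k * r) := e *t w.

Lemma tens_row_mulmx (e : 'rV[R]_k) (w : 'rV[R]_r) x :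
  (tens_row e w *m x) 0 0 = \sum_i e 0 i * (w *m agent_state i x) 0 0.
Proof.
rewrite mxE sum_mxtens; apply: eq_bigr => i _.
rewrite mxE mulr_sumr; apply: eq_bigr => a _.
by rewrite !mxE mxtens_indexK !ord1 mulrA.
Qed.

Lemma tens_row_lin (e : 'rV[R]_k) (a : R) (u v : 'rV[R]_r) :
  tens_row e (a *: u + v) = a *: tens_row e u + tens_row e v.
Proof. by apply/matrixP => i j; rewrite !mxE; ring. Qed.

Lemma tens_row_mul (e : 'rV[R]_k) (w : 'rV[R]_r) (S : 'M[R]_k) (Q : 'M[R]_r) :
  tens_row e w *m (S *t Q) = tens_row (e *m S) (w *m Q).
Proof. exact: (@tensmx_mul R 1 k 1 r). Qed.

Lemma tens_quadratic_form (S : 'M[R]_k) (Q : 'M[R]_r) x :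
  (x^T *m (S *t Q) *m x) 0 0 =
  \sum_i \sum_j S i j * ((agent_state i x)^T *m Q *m agent_state j x) 0 0.
Proof.
rewrite -mulmxA mxE sum_mxtens; apply: eq_bigr => i _.
transitivity (((agent_state i x)^T *m agent_state i ((S *t Q) *m x)) 0 0).
  by rewrite mxE; apply: eq_bigr => a _; rewrite !mxE.
rewrite agent_state_tens_mul mulmx_sumr summxE; apply: eq_bigr => j _.
by rewrite -scalemxAr mxE mulmxA.
Qed.

Lemma tens1_quadratic_form (Q : 'M[R]_r) x :
  (x^T *m (1%:M *t Q) *m x) 0 0 =
  \sum_i ((agent_state i x)^T *m Q *m agent_state i x) 0 0.
Proof.
rewrite tens_quadratic_form; apply: eq_bigr => i _.
rewrite (bigD1 i)//= mxE eqxx mul1r big1 ?addr0// => j ji.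
by rewrite mxE eq_sym (negbTE ji) mul0r.
Qed.

Lemma tens1_posdef (K : 'M[R]_r) :
  sym_posdef K -> sym_posdef (1%:M *t K : 'M[R]_(k * r)).
Proof.
move=> Kpos; have [symK posK] := Kpos.
split=> [|x x0]; first by rewrite trmx_tens trmx1 symK.
have [i xi] : exists i, agent_state i x != 0.
  apply/existsP; apply: contraNT x0; rewrite negb_exists => /forallP x0.
  apply/eqP/colP => c; case: (mxtens_indexP c) => i a.
  by move: (x0 i); rewrite negbK => /eqP/colP/(_ a); rewrite !mxE.
rewrite tens1_quadratic_form (bigD1 i)//=.
by rewrite ltr_pwDl ?posK// sumr_ge0// => j _; exact: posdef_ge0.
Qed.

End Kronecker.

(** * Synchronization of passive networks *)

Section Network.
Variables (R : realType) (k r m : nat).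
Variables (A : 'M[R]_r) (B : 'M[R]_(r, m)) (C : 'M[R]_(m, r)) (L : 'M[R]_k).
Hypothesis lapL : connected_laplacian L.

Local Notation M := (1%:M *t A - L *t (B *m C)).

(** [C = B^T K] turns the coupling into [- 2 (L (x) C^T C)], whose quadratic form
    is computed output by output with [laplacian_dirichlet]. *)
Lemma network_dissipation (K : 'M[R]_r) (w : 'M[R]_k) (x : 'cV[R]_(k * r)) :
  passivity_certificate A B C K ->
  (forall i j, w i j = w j i) ->
  (forall i j, i != j -> L i j = - w i j) ->
  (forall i, L i i = \sum_(j | j != i) w i j) ->
  (x^T *m (M^T *m (1%:M *t K) + (1%:M *t K) *m M) *m x) 0 0 =
  \sum_i ((agent_state i x)^T *m (A^T *m K + K *m A) *m agent_state i x) 0 0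
  - \sum_c \sum_i \sum_j w i j *
      ((row c C *m agent_state i x) 0 0 - (row c C *m agent_state j x) 0 0) ^+ 2.
Proof.
move=> [[symK _] _ CK] wsym Loff Ldiag.
have BK : K *m B = C^T by rewrite CK trmx_mul trmxK symK.
have -> : M^T *m (1%:M *t K) + (1%:M *t K) *m M =
    1%:M *t (A^T *m K + K *m A) - 2 *: (L *t (C^T *m C)).
  rewrite linearB/= !trmx_tens trmx1 (laplacian_sym wsym Loff).
  rewrite mulmxBl mulmxBr !tensmx_mul !mul1mx !mulmx1 mulmxA BK.
  rewrite trmx_mul -mulmxA -CK.
  by apply/matrixP => a b; rewrite !mxE; ring.
rewrite mulmxBr mulmxBl mxE [in X in _ + X]mxE tens1_quadratic_form.
congr (_ - _).
rewrite -scalemxAr -scalemxAl mxE tens_quadratic_form.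
pose y i c := (row c C *m agent_state i x) 0 0.
transitivity (\sum_c 2 * (\sum_i \sum_j L i j * (y i c * y j c))); last first.
  apply: eq_bigr => c _.
  by rewrite (laplacian_dirichlet wsym Loff Ldiag (y ^~ c)).
rewrite -mulr_sumr [in RHS]exchange_big/=; congr (_ * _); apply: eq_bigr => i _.
rewrite [in RHS]exchange_big/=; apply: eq_bigr => j _.
rewrite -mulr_sumr; congr (_ * _).
rewrite mulmxA -trmx_mul -mulmxA mxE; apply: eq_bigr => c _.
by rewrite /y -!row_mul !mxE.
Qed.

Lemma agents_dissipation_le0 (K : 'M[R]_r) (x : 'cV[R]_(k * r)) :
  passivity_certificate A B C K ->
  \sum_i ((agent_state i x)^T *m (A^T *m K + K *m A) *m agent_state i x) 0 0 <= 0.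
Proof.
move=> [_ Kdiss _]; apply: sumr_le0 => i _; have := Kdiss (agent_state i x).
by rewrite mulmx0 mul0mx [leRHS]mxE.
Qed.

Lemma network_lyapunov (K : 'M[R]_r) :
  passivity_certificate A B C K ->
  loewner_le (M^T *m (1%:M *t K) + (1%:M *t K) *m M) 0.
Proof.
move=> certK x; have [w [wsym w0 Loff Ldiag _]] := lapL.
rewrite mulmx0 mul0mx [leRHS]mxE (network_dissipation _ certK wsym Loff Ldiag).
rewrite subr_le0 (le_trans (agents_dissipation_le0 _ certK))//.
by do 3!(apply: sumr_ge0 => ? _); rewrite mulr_ge0// sqr_ge0.
Qed.

Variable x : R -> 'cV[R]_(k * r).
Hypothesis xM : trajectory M x.

(** The condition on [e] says that [tens_row e w] vanishes when all agents agree.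
    Quantifying over every such [e] at once is what makes the property stable
    under the generator, which replaces [e] by [e *m L] in the coupling term. *)
Definition disagreement_decays (w : 'rV[R]_r) :=
  forall e : 'rV[R]_k, e *m ones k = 0 -> decays x (tens_row e w).

Lemma disagreement_decays_lin a u v :
  disagreement_decays u -> disagreement_decays v ->
  disagreement_decays (a *: u + v).
Proof.
move=> du dv e e0.
by rewrite tens_row_lin; apply: decays_lin; [exact: du|exact: dv].
Qed.

Lemma disagreement_decays0 : disagreement_decays 0.
Proof.
move=> e e0; rewrite /tens_row tensmx0 /decays.
have -> : (fun t => ((0 : 'rV_(k * r)) *m x t) 0 0) = fun=> 0.
  by apply/funext => t; rewrite mul0mx mxE.
exact: cvg_cst.
Qed.

(** The dissipation tends to [0] and dominates each [w_ij (y_i - y_j)^2], so output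
    differences decay along edges, then along paths, that is between any two
    agents. *)
Lemma disagreement_decays_output (K : 'M[R]_r) (c : 'I_m) :
  passivity_certificate A B C K -> disagreement_decays (row c C).
Proof.
move=> certK; case: (certK) => Kpos _ _.
have [w [wsym w0 Loff Ldiag wconn]] := lapL.
pose y i t := (row c C *m agent_state i (x t)) 0 0.
have DE := network_dissipation _ certK wsym Loff Ldiag.
have edge_ge0 (v : 'cV[R]_(k * r)) d i j : 0 <= w i j *
    ((row d C *m agent_state i v) 0 0 - (row d C *m agent_state j v) 0 0) ^+ 2.
  by rewrite mulr_ge0// sqr_ge0.
have [_ Dlim] := lyapunov_dissipation xM (tens1_posdef k Kpos) (network_lyapunov certK).
have edge i j : 0 < w i j -> y i t - y j t @[t --> +oo] --> (0 : R).
  move=> wij; apply: (cvg0_of_sqr_le wij); last by have := cvgN Dlim; rewrite oppr0; exact.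
  apply: nearW => t; rewrite DE opprB ler_wpDr// ?oppr_ge0 ?agents_dissipation_le0//.
  rewrite (bigD1 c)//= (bigD1 i)//= (bigD1 j)//= -!addrA lerDl.
  by rewrite !addr_ge0//; do !(apply: sumr_ge0 => ? _).
have consensus i j : y i t - y j t @[t --> +oo] --> (0 : R).
  have /connectP[p] := wconn i j.
  elim: p i => [|i' p IHp] i /= => [_ ->|/andP[wii' ip] jp].
    have -> : (fun t => y i t - y i t) = fun=> 0 by apply/funext => t; rewrite subrr.
    exact: cvg_cst.
  have -> : (fun t => y i t - y j t) = (fun t => (y i t - y i' t) + (y i' t - y j t)).
    by apply/funext => t; rewrite addrA subrK.
  by have := cvgD (edge _ _ wii') (IHp _ ip jp); rewrite addr0; exact.
move=> e e1.
(* As [e] sums to zero, every output may be compared with that of a fixed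
   agent [i0]. *)
have [i0 _|no_agent] := pickP (fun _ : 'I_k => true); last first.
  have -> : tens_row e (row c C) = tens_row e 0.
    by apply/rowP => i; have := no_agent (mxtens_unindex i).1.
  exact: disagreement_decays0.
rewrite /decays.
have -> : (fun t => (tens_row e (row c C) *m x t) 0 0) =
          \sum_i (fun t => e 0 i * (y i t - y i0 t)).
  apply/funext => t; rewrite fct_sumE tens_row_mulmx.
  under [RHS]eq_bigr do rewrite mulrBr.
  rewrite sumrB -mulr_suml.
  have -> : \sum_i e 0 i = 0.
    transitivity ((e *m ones k) 0 0); last by rewrite e1 mxE.
    by rewrite mxE; apply: eq_bigr => i _; rewrite mxE mulr1.
  by rewrite mul0r subr0.
apply: (big_ind (fun f : R -> R => f t @[t --> +oo] --> (0 : R))).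
- exact: cvg_cst.
- by move=> f g f0 g0; have := cvgD f0 g0; rewrite addr0; exact.
- by move=> i _; have := cvgM (cvg_cst (e 0 i)) (consensus i i0); rewrite mulr0; exact.
Qed.

(** The generator maps [e (x) w] to [e (x) w A - e L (x) w B C].  Since
    [e L] again sums to zero and [w B C] is a combination of outputs, the
    second form is already known to decay. *)
Lemma disagreement_decays_generator (K : 'M[R]_r) (w : 'rV[R]_r) :
  passivity_certificate A B C K ->
  disagreement_decays w -> disagreement_decays (w *m A).
Proof.
move=> certK dw e e1; case: (certK) => Kpos _ _.
have [bx _] := lyapunov_dissipation xM (tens1_posdef k Kpos) (network_lyapunov certK).
have [W [_ _ Loff Ldiag _]] := lapL.
have eL1 : (e *m L) *m ones k = 0.
  by rewrite -mulmxA (laplacian_mul_ones Loff Ldiag) mulmx0.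
have coupling : disagreement_decays (w *m (B *m C)).
  rewrite mulmxA mulmx_sum_row; apply: (big_ind disagreement_decays).
  - exact: disagreement_decays0.
  - by move=> u v du dv; rewrite -[u]scale1r; exact: disagreement_decays_lin.
  - move=> c _; rewrite -[X in disagreement_decays X]addr0.
    apply: disagreement_decays_lin; last exact: disagreement_decays0.
    exact: disagreement_decays_output certK.
have -> : tens_row e (w *m A) =
    1 *: tens_row (e *m L) (w *m (B *m C)) + tens_row e w *m M.
  by rewrite mulmxBr !tens_row_mul mulmx1 scale1r addrC subrK.
apply: decays_lin; first exact: coupling.
exact: decays_generator bx (dw _ e1).
Qed.

Lemma passive_network_synchronizes :
  passive A B C -> minimal_realization A B C ->
  forall i j : 'I_k,
    agent_state i (x t) - agent_state j (x t) @[t --> +oo] --> (0 : 'cV[R]_r).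
Proof.
move=> [K certK] minABC i j.
have all_decay : forall w, disagreement_decays w.
  apply: (observability_ind minABC).
  - exact: disagreement_decays0.
  - exact: disagreement_decays_lin.
  - by move=> c; exact: disagreement_decays_output certK.
  - by move=> w; exact: disagreement_decays_generator certK.
pose e : 'rV[R]_k := delta_mx 0 i - delta_mx 0 j.
have e1 : e *m ones k = 0.
  by apply/rowP => c; rewrite /e mulmxBl -!rowE !mxE subrr.
have entry a t : (agent_state i (x t) - agent_state j (x t)) a 0 =
    (tens_row e (delta_mx 0 a) *m x t) 0 0.
  rewrite tens_row_mulmx.
  transitivity (((e : 'rV_k) *m (\col_i' (agent_state i' (x t) a 0))) 0 0).
    by rewrite /e mulmxBl -!rowE !mxE.
  rewrite mxE; apply: eq_bigr => i' _.
  by rewrite -rowE !mxE.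
apply/cvgr0Pnorm_le => /= eps eps0; near=> t.
rewrite /Num.Def.normr/= mx_normrE (bigmax_le _ (ltW eps0))//= => -[a b] _ /=.
rewrite (ord1 b) entry; move: a {b}; near: t; apply: filter_forall => a.
by have /cvgr0Pnorm_le/(_ _ eps0) := all_decay (delta_mx 0 a) e e1.
Unshelve. all: by end_near.
Qed.

End Network.

Theorem theorem13 (R : realType)
  (* agents *)
  (n m : nat) (A : 'M[R]_n) (B : 'M[R]_(n, m)) (C : 'M[R]_(m, n))
  (hmin : minimal_realization A B C) (hpass : passive A B C)
  (Km KM : 'M[R]_n)
  (hKm : min_certificate A B C Km) (hKM : max_certificate A B C KM)
  (* network; N = \sum_i mult i + 1, mult i being the multiplicity of lam i *)
  (s : nat) (mult : 'I_s -> nat) (lam : 'I_s -> R) (p q : nat)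
  (L : 'M[R]_(\sum_(i < s) mult i + 1))
  (F : 'M[R]_(\sum_(i < s) mult i + 1, p))
  (H : 'M[R]_(q, \sum_(i < s) mult i + 1))
  (hL : connected_laplacian L)
  (hmult : forall i, (0 < mult i)%N)
  (hlam_pos : forall i, 0 < lam i)
  (hlam_dec : forall i j : 'I_s, (i < j)%N -> lam j < lam i)
  (Lam : 'M[R]_(\sum_(i < s) mult i))
  (hLam : Lam = \mxdiag_i (lam i)%:M)
  (T1 : 'M[R]_(\sum_(i < s) mult i + 1, \sum_(i < s) mult i))
  (T2 : 'cV[R]_(\sum_(i < s) mult i + 1))
  (hT2 : T2 = (Num.sqrt (\sum_(i < s) mult i + 1)%N%:R)^-1 *: ones _)
  (hT : (row_mx T1 T2)^T *m row_mx T1 T2 = 1%:M)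
  (hLT : L = row_mx T1 T2 *m block_mx Lam 0 0 0 *m (row_mx T1 T2)^T)
  (Fbar : 'M[R]_(\sum_(i < s) mult i, p)) (hFbar : Fbar = T1^T *m F)
  (Hbar : 'M[R]_(q, \sum_(i < s) mult i)) (hHbar : Hbar = H *m T1)
  (* balancing *)
  (X Y : 'M[R]_(\sum_(i < s) mult i)) (Yb : forall i : 'I_s, 'M[R]_(mult i))
  (hXpos : sym_posdef X)
  (hX : - Lam *m X - X *m Lam + Fbar *m Fbar^T = 0)
  (hYdiag : Y = \mxdiag_i Yb i)
  (hYpos : forall i, sym_posdef (Yb i))
  (hY : loewner_le (- Lam *m Y - Y *m Lam + Hbar^T *m Hbar) 0)
  (TG : 'M[R]_(\sum_(i < s) mult i)) (sigma : 'rV[R]_(\sum_(i < s) mult i))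
  (hTG : TG \in unitmx)
  (hTGX : TG *m X *m TG^T = diag_mx sigma)
  (hTGY : (invmx TG)^T *m Y *m invmx TG = diag_mx sigma)
  (hsigma : nonincreasing_diag sigma)
  (TD : 'M[R]_n) (tau : 'rV[R]_n)
  (hTD : TD \in unitmx)
  (hTDM : TD *m invmx KM *m TD^T = diag_mx tau)
  (hTDm : (invmx TD)^T *m Km *m invmx TD = diag_mx tau)
  (htau : nonincreasing_diag tau)
  (* truncation to k = k1 + 1 nodes *)
  (k1 : nat) (hk : (k1 <= \sum_(i < s) mult i)%N)
  (Lam1 : 'M[R]_k1) (F1 : 'M[R]_(k1, p)) (H1 : 'M[R]_(q, k1))
  (hLam1 : Lam1 = leading_block hk (TG *m Lam *m invmx TG))
  (hF1 : F1 = first_rows hk (TG *m Fbar))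
  (hH1 : H1 = first_cols hk (Hbar *m invmx TG))
  (* truncation to agents of order r, with minimal realization of order rh *)
  (r : nat) (hr : (r <= n)%N)
  (rh : nat) (Ah : 'M[R]_rh) (Bh : 'M[R]_(rh, m)) (Ch : 'M[R]_(m, rh))
  (hred : reduce_to_minimal (leading_block hr (TD *m A *m invmx TD))
            (first_rows hr (TD *m B)) (first_cols hr (C *m invmx TD)) Ah Bh Ch)
  (hpassh : passive Ah Bh Ch) (hminh : minimal_realization Ah Bh Ch)
  (* network realization *)
  (NN : 'M[R]_(k1 + 1)) (FF : 'M[R]_(k1 + 1, p)) (HH : 'M[R]_(q, k1 + 1))
  (hNN : NN = block_mx Lam1 0 0 0)
  (hFF : FF = col_mx F1
           ((Num.sqrt (\sum_(i < s) mult i + 1)%N%:R)^-1 *: ((ones _)^T *m F)))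
  (hHH : HH = row_mx H1
           ((Num.sqrt (\sum_(i < s) mult i + 1)%N%:R)^-1 *: (H *m ones _)))
  (Tn : 'M[R]_(k1 + 1)) (hTn : Tn \in unitmx)
  (Lh : 'M[R]_(k1 + 1)) (Fh : 'M[R]_(k1 + 1, p)) (Hh : 'M[R]_(q, k1 + 1))
  (hLh : Lh = invmx Tn *m NN *m Tn)
  (hLh_lap : connected_laplacian Lh)
  (hFh : Fh = invmx Tn *m FF) (hHh : Hh = HH *m Tn) :
  forall (x0 : 'cV[R]_((k1 + 1) * rh)) (x : R -> 'cV[R]_((k1 + 1) * rh))
         (y : R -> 'cV[R]_(q * m)),
    solution (1%:M *t Ah - Lh *t (Bh *m Ch)) (Fh *t Bh) (Hh *t Ch) x0
      (fun _ => 0) x y ->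
    forall i j : 'I_(k1 + 1),
      agent_state i (x t) - agent_state j (x t) @[t --> +oo] --> (0 : 'cV[R]_rh).
Proof.
move=> x0 x y [_ _ xder _].
have xM : trajectory (1%:M *t Ah - Lh *t (Bh *m Ch)) x.
  by move=> t /xder; rewrite mulmx0 addr0.
exact (passive_network_synchronizes hLh_lap xM hpassh hminh).
Qed.
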